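(* Let $\mathcal{H}$ be an $n$-dimensional Hilbert space and let $(W,1)=\{(W_i,1)\}_{i\in I_m}$ be a Riesz fusion basis of $\mathcal{H}$ with fusion frame operator $S_W$. Then there exists an orthonormal basis $\{e_j\}_{j\in I_n}$ of $\mathcal{H}$ such that $F=\{\pi_{S_W^{-1/2}W_i}e_j\}_{j\in I_n,\,i\in I_m}$ is a Parseval frame for $\mathcal{H}$ and, for every sequence $(V,1)=\{(V_i,1)\}_{i\in I_m}$ of subspaces of $\mathcal{H}$ satisfying $S_W^{-1/2}W_i\subseteq V_i$ for all $i\in I_m$, the family $\{\pi_{V_i}e_j\}_{j\in I_n,\,i\in I_m}$ is a ($1$-loss) optimal dual frame of $F$ with respect to the operator norm.
   Context: $I_m=\{1,\dots,m\}$; $\pi_X$ is the orthogonal projection onto a subspace $X$. For subspaces $W_i$ with all weights equal to $1$, $S_Wf=\sum_{i\in I_m}\pi_{W_i}f$; it is positive and invertible when the $W_i$ span $\mathcal{H}$. The family $\{(W_i,1)\}_{i\in I_m}$ is a Riesz fusion basis if the $W_i$ span $\mathcal{H}$ and there are constants $0<A\le B$ with $A\sum_{i\in J}\|f_i\|^2\le\|\sum_{i\in J}f_i\|^2\le B\sum_{i\in J}\|f_i\|^2$ for all finite $J\subset I_m$ and $f_i\in W_i$. Fusion frames are assumed non-trivial: $W_i\ne\mathcal{H}$ for at least one $i$. A finite family $F=\{f_k\}_{k\in K}$ spanning $\mathcal{H}$ is a frame, and it is Parseval if $\sum_k|\langle f,f_k\rangle|^2=\|f\|^2$ for all $f\in\mathcal{H}$.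 A family $G=\{g_k\}_{k\in K}$ is a dual frame of $F$ if $\sum_k\langle f,f_k\rangle g_k=f$ for all $f\in\mathcal{H}$. For a dual $G$ of $F$ put $d_1(F,G)=\max_{k\in K}\|g_k\otimes f_k\|$, where $(g_k\otimes f_k)f=\langle f,f_k\rangle g_k$ and $\|\cdot\|$ is the operator norm (so $d_1(F,G)=\max_k\|g_k\|\,\|f_k\|$). $G$ is a $1$-loss optimal dual frame of $F$ if $d_1(F,G)=\min\{d_1(F,Y):Y\text{ is a dual of }F\}$. *)

(* Defs.v *)
From HB Require Import structures.
From mathcomp Require Import all_boot all_order all_algebra.
From mathcomp Require Import complex.
From mathcomp Require Import boolp classical_sets reals.

Set Implicit Arguments.
Unset Strict Implicit.
Unset Printing Implicit Defensive.

Import Order.TTheory GRing.Theory Num.Theory.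
Local Open Scope ring_scope.

(* The scalar field K of a Hilbert space, with its conjugation [conj] and its
   real part [re] : either the reals R or the complex numbers R[i]. *)
Variant real_or_complex (R : realType) :
    forall K : numFieldType, {rmorphism K -> K} -> (K -> R) -> Prop :=
  | RealScalars : @real_or_complex R R idfun idfun
  | ComplexScalars : @real_or_complex R R[i] Num.conj (@complex.Re R).

Section HilbertSpace.
Variables (R : realType) (K : numFieldType) (conj : {rmorphism K -> K}).
Variable re : K -> R.
Variables (H : vectType K) (dot : {dot H for conj}).

Definition hnorm (x : H) : R := Num.sqrt (re (dot x x)).

Definition modulus (a : K) : R := re `|a|.

(* orthogonal projection onto X : the projection onto X along its orthogonal
   complement *)
Definition oproj (X : {vspace H}) : 'End(H) := daddv_pi X (orthov dot X).

Definition orthonormal_basis n (e : n.-tuple H) : Prop :=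
  orthonormal dot e /\ basis_of fullv e.

Definition opnorm (T : H -> H) : R :=
  sup [set hnorm (T x) | x in [set x | hnorm x <= 1]]%classic.

Definition rank_one (g f : H) : H -> H := fun x => dot x f *: g.

(* the symmetry clause is automatic over R[i], but not over R *)
Definition positive_op (T : 'End(H)) : Prop :=
  (forall x y, dot (T x) y = dot x (T y)) /\ (forall x, 0 <= dot (T x) x).

(* the positive square root of T (a junk value if there is none) *)
Definition sqrt_op (T : 'End(H)) : 'End(H) :=
  xget 0 [set Q : 'End(H) | positive_op Q /\ (Q \o Q)%VF = T]%classic.

Definition inv_sqrt_op (T : 'End(H)) : 'End(H) := sqrt_op (T^-1)%VF.

Section FusionFrames.
Variables (m : nat) (W : 'I_m -> {vspace H}).

Definition fusion_frame_op : 'End(H) := \sum_(i < m) oproj (W i).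

Definition nontrivial_family : Prop := exists i, W i <> fullv.

Definition riesz_fusion_basis : Prop :=
  (\sum_(i < m) W i)%VS = fullv /\
  exists A B : R, [/\ 0 < A, A <= B &
    forall (J : {set 'I_m}) (f : 'I_m -> H), (forall i, i \in J -> f i \in W i) ->
      A * (\sum_(i in J) hnorm (f i) ^+ 2) <= hnorm (\sum_(i in J) f i) ^+ 2
        <= B * (\sum_(i in J) hnorm (f i) ^+ 2)].

End FusionFrames.

Section Frames.
Variables (I : finType) (F : I -> H).

Definition frame : Prop := <<codom F>>%VS = fullv.

Definition parseval_frame : Prop :=
  frame /\ forall f, \sum_k modulus (dot f (F k)) ^+ 2 = hnorm f ^+ 2.

Definition dual_frame (G : I -> H) : Prop :=
  forall f, \sum_k dot f (F k) *: G k = f.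

(* operator norms are nonnegative, so starting the maximum at 0 is harmless *)
Definition d1 (G : I -> H) : R :=
  \big[Num.max/0]_k opnorm (rank_one (G k) (F k)).

Definition one_loss_optimal_dual (G : I -> H) : Prop :=
  dual_frame G /\ forall Y, dual_frame Y -> d1 G <= d1 Y.

End Frames.

(* the family of the orthogonal projections of e_j onto U_i *)
Definition proj_family n m (e : n.-tuple H) (U : 'I_m -> {vspace H})
    (k : 'I_n * 'I_m) : H := oproj (U k.2) (tnth e k.1).

End HilbertSpace.

(* Main.v *)
(* With S the fusion frame operator, the directness of the sum of the W_i gives
   pi_{W_i} S^-1 w = 0 for w in W_j, j <> i, so the subspaces U_i = S^{-1/2} W_i
   form an orthogonal decomposition of H.  Take for e an orthonormal basis adapted
   to it: each pi_{U_i} e_j is then e_j or 0, and F is e padded with zeros.  A dual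
   of F is forced to agree with F where F_k = e_j, so d_1 >= 1 for every dual, while
   d_1 <= 1 for the duals pi_{V_i} e_j since projections are contractions.  The
   square root and the adapted basis both come from diagonalizing a positive
   operator. *)

From HB Require Import structures.
From mathcomp Require Import all_boot all_order all_algebra.
From mathcomp Require Import complex spectral.
From mathcomp Require Import boolp classical_sets reals.
Require Import Defs.

Set Implicit Arguments.
Unset Strict Implicit.
Unset Printing Implicit Defensive.

Import Order.TTheory GRing.Theory Num.Theory.
Local Open Scope ring_scope.

(** * Scalar facts shared by the real and complex cases *)

Section Scalars.
Variables (R : realType) (K : numFieldType)
    (conj : {rmorphism K -> K}) (re : K -> R).
Hypothesis (hK : real_or_complex conj re).

Lemma re_add : {morph re : a b / a + b}.
Proof. by case: hK => // -[a b] [c d]. Qed.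

Lemma re_le : {homo re : a b / a <= b}.
Proof. by case: hK => // a b; rewrite lecE => /andP[]. Qed.

Lemma re0 : re 0 = 0.
Proof. by case: hK. Qed.

Lemma re1 : re 1 = 1.
Proof. by case: hK. Qed.

Lemma re_eq0 a : 0 <= a -> re a = 0 -> a = 0.
Proof.
move: a; case: hK => // a; rewrite lecE => /andP[/eqP i0 _] r0.
by apply/eqP; rewrite eq_complex r0 i0 !eqxx.
Qed.

Lemma re_sum (I : Type) (s : seq I) (P : pred I) (f : I -> K) :
  re (\sum_(i <- s | P i) f i) = \sum_(i <- s | P i) re (f i).
Proof. exact: (big_morph _ re_add re0). Qed.

Lemma nonneg_conj a : 0 <= a -> conj a = a.
Proof. by move: a; case: hK => // a /geC0_conj. Qed.

Lemma mul_conj_ge0 a : 0 <= a * conj a.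
Proof.
by move: a; case: hK => a /=; [exact: sqr_ge0 | exact: mul_conjC_ge0].
Qed.

Lemma modulus_sqr a : modulus re a ^+ 2 = re (a * conj a).
Proof.
rewrite /modulus; move: a; case: hK => a /=; first by rewrite real_normK ?num_real.
by rewrite -normCK !expr2 /=; simpc; case: a.
Qed.

Lemma nonneg_sqrt (a : K) : 0 <= a -> exists2 b, 0 <= b & b * b = a.
Proof.
move: a; case: hK => a a0 /=.
  by exists (Num.sqrt a); rewrite ?sqrtr_ge0 -?expr2 ?sqr_sqrtr.
by exists (sqrtC a); rewrite ?sqrtC_ge0 -?expr2 ?sqrtCK.
Qed.

End Scalars.

(** Coordinates in [vbasis X] transport [T] restricted to [X] to a matrix acting on row vectors, so
    that matrix eigenvalues yield eigenvectors of [T] lying inside [X]. *)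
Lemma matrix_of_stable (K : fieldType) (H : vectType K) (T : 'End(H))
    (X : {vspace H}) : (T @: X <= X)%VS ->
  exists (phi : {linear 'rV[K]_(\dim X) -> H}) (M : 'M[K]_(\dim X)),
    [/\ injective phi, forall v, phi v \in X & forall v, T (phi v) = phi (v *m M)].
Proof.
move=> TX.
pose f (v : 'rV[K]_(\dim X)) : H := \sum_i v 0 i *: (vbasis X)`_i.
have f_lin : linear f.
  move=> a u v; rewrite /f scaler_sumr -big_split; apply: eq_bigr => i _ /=.
  by rewrite !mxE scalerDl scalerA.
pose lf := GRing.isLinear.Build K _ _ _ f f_lin.
pose phi : {linear 'rV[K]_(\dim X) -> H} := HB.pack f lf.
pose M := \matrix_(i, j < \dim X) coord (vbasis X) j (T (vbasis X)`_i).
have free_b := basis_free (vbasisP X).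
exists phi, M; split => [u v /= uv|v|v] /=.
- by apply/rowP => i; rewrite -(coord_sum_free (fun i => u 0 i) i free_b) -/(f u)
    [f u]uv coord_sum_free.
- by apply: memv_suml => i _; rewrite memvZ ?vbasis_mem ?mem_nth ?size_tuple.
- rewrite {1}/f linear_sum /f /=.
  under [RHS]eq_bigr => j _ do rewrite mxE scaler_suml.
  rewrite exchange_big /=; apply: eq_bigr => i _.
  rewrite linearZ /=.
  have Tb : T (vbasis X)`_i \in X.
    by apply: (subvP TX); rewrite memv_img ?vbasis_mem ?mem_nth ?size_tuple.
  rewrite [in LHS](coord_vbasis Tb) scaler_sumr; apply: eq_bigr => j _.
  by rewrite mxE scalerA.
Qed.

(** * Inner product calculus and the norm it induces *)

Section Dot.
Variables (R : realType) (K : numFieldType)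
    (conj : {rmorphism K -> K}) (re : K -> R).
Hypothesis (hK : real_or_complex conj re).
Variables (H : vectType K) (dot : {dot H for conj}).
Implicit Types (x y z : H) (X Y : {vspace H}) (T : 'End(H)).

Lemma dotC x y : dot x y = conj (dot y x).
Proof. by rewrite hermC mul1r. Qed.

Lemma dotZl a x y : dot (a *: x) y = a * dot x y.
Proof. by rewrite linearZl_LR. Qed.

Lemma dotZr a x y : dot x (a *: y) = conj a * dot x y.
Proof. by rewrite linearZr_LR. Qed.

Lemma dotBl x y z : dot (x - y) z = dot x z - dot y z.
Proof. exact: linearBl. Qed.

Lemma dotBr x y z : dot z (x - y) = dot z x - dot z y.
Proof. exact: linearBr. Qed.

Lemma dotDl x y z : dot (x + y) z = dot x z + dot y z.
Proof. exact: linearDl. Qed.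

Lemma dot0l x : dot 0 x = 0.
Proof. exact: linear0l. Qed.

Lemma dot0r x : dot x 0 = 0.
Proof. exact: linear0r. Qed.

Lemma dot_suml I (s : seq I) (P : pred I) (f : I -> H) y :
  dot (\sum_(i <- s | P i) f i) y = \sum_(i <- s | P i) dot (f i) y.
Proof. exact: linear_sumlz. Qed.

Lemma dot_sumr I (s : seq I) (P : pred I) (f : I -> H) x :
  dot x (\sum_(i <- s | P i) f i) = \sum_(i <- s | P i) dot x (f i).
Proof. exact: linear_sumr. Qed.

Lemma dot_ge0 x : 0 <= dot x x.
Proof.
have [->|x0] := eqVneq x 0; first by rewrite linear0r.
exact/ltW/neq0_dnorm_gt0.
Qed.

Lemma dot_eq0 x : (dot x x == 0) = (x == 0).
Proof.
have [->|x0] := eqVneq x 0; first by rewrite linear0r eqxx.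
by rewrite gt_eqF // neq0_dnorm_gt0.
Qed.

Lemma hnorm_sqr x : hnorm re dot x ^+ 2 = re (dot x x).
Proof. by rewrite sqr_sqrtr // -(re0 hK) (re_le hK) // dot_ge0. Qed.

Lemma hnorm_eq0 x : hnorm re dot x = 0 -> x = 0.
Proof.
move=> x0; apply/eqP; rewrite -dot_eq0; apply/eqP/(re_eq0 hK); first exact: dot_ge0.
by rewrite -hnorm_sqr x0 expr0n.
Qed.

End Dot.

(* A complex eigenvalue a + ib of T makes (T - a)^2 + b^2 singular over R; at a kernel
   vector x, symmetry gives |(T - a) x|^2 = - b^2 |x|^2, whence T x = a x. *)
Lemma real_eigenvector (R : realType) (H : vectType R) (dot : {dot H for @idfun R})
    (T : 'End(H)) (X : {vspace H}) :
    (forall x y, dot (T x) y = dot x (T y)) -> (T @: X <= X)%VS -> X != 0%VS ->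
  exists x a, [/\ x \in X, x != 0 & T x = a *: x].
Proof.
move=> T_sym /matrix_of_stable[phi [M [phi_inj phiX phiM]]] X0.
have d0 : (0 < \dim X)%N by rewrite lt0n dimv_eq0.
have [[a b] /eigenvalueP[w wM w0]] :=
  eigenvalue_closed (map_mx (real_complex R) M) d0.
pose N := M - a%:M.
have /eqP/det0P[v v0 vB] : \det (N *m N + (b * b)%:M) = 0.
  (* The determinant vanishes over [R[i]], where [w N = i b w] gives [w (N^2 + b^2) = 0].
     Injectivity of the embedding brings this back to [R], and with it a real kernel vector. *)
  apply: (@complexI R); rewrite rmorph0 -det_map_mx; apply/eqP/det0P.
  have wN : w *m map_mx (real_complex R) N = (0 +i* b)%C *: w.
    rewrite map_mxB map_scalar_mx mulmxBr wM mul_mx_scalar -scalerBl.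
    by congr (_ *: _); apply/eqP; rewrite eq_complex /=; simpc.
  exists w => //; rewrite map_mxD map_mxM map_scalar_mx mulmxDr mulmxA wN.
  rewrite -scalemxAl wN mul_mx_scalar scalerA -scalerDl.
  by rewrite -[RHS](scale0r w); congr (_ *: _); apply/eqP; rewrite eq_complex /=; simpc;
    rewrite addNr !eqxx.
exists (phi v), a; split => //; first by rewrite -(raddf0 phi) (inj_eq phi_inj).
set x := phi v; set y := T x - a *: x.
have phiN u : T (phi u) - a *: phi u = phi (u *m N).
  by rewrite phiM -linearZ -linearB /= mulmxBr mul_mx_scalar.
have yy : dot y y = - (b * b) * dot x x.
  have T_sub_sym u w' : dot (T u - a *: u) w' = dot u (T w' - a *: w').
    by rewrite dotBl dotBr T_sym dotZl dotZr.
  rewrite {1}/y T_sub_sym.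
  have -> : T y - a *: y = - (b * b) *: x; last by rewrite dotZr.
  rewrite /y phiN phiN scaleNr; apply/eqP.
  by rewrite -addr_eq0 -linearZ -raddfD /= -mul_mx_scalar -mulmxA -mulmxDr vB raddf0.
have y0 : y == 0.
  rewrite -(dot_eq0 dot) eq_le dot_ge0 andbT yy mulNr oppr_le0.
  by rewrite mulr_ge0 ?dot_ge0 // -expr2 sqr_ge0.
by apply/eqP; rewrite -subr_eq0.
Qed.

Lemma complex_eigenvector (C : numClosedFieldType) (H : vectType C)
    (T : 'End(H)) (X : {vspace H}) : (T @: X <= X)%VS -> X != 0%VS ->
  exists x a, [/\ x \in X, x != 0 & T x = a *: x].
Proof.
move=> /matrix_of_stable[phi [M [phi_inj phiX phiM]]] X0.
have d0 : (0 < \dim X)%N by rewrite lt0n dimv_eq0.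
have [a /eigenvalueP[v vM v0]] := eigenvalue_closed M d0.
exists (phi v), a; split => //; first by rewrite -(raddf0 phi) (inj_eq phi_inj).
by rewrite phiM vM linearZ.
Qed.

(** * Spectral theorem and square roots of positive operators *)

Section Spectral.
Variables (R : realType) (K : numFieldType)
    (conj : {rmorphism K -> K}) (re : K -> R).
Hypothesis (hK : real_or_complex conj re).
Variables (H : vectType K) (dot : {dot H for conj}).
Implicit Types (x y z : H) (X Y : {vspace H}) (T : 'End(H)) (s : seq H).

Lemma positive_op_eigenvector T X : positive_op dot T ->
    (T @: X <= X)%VS -> X != 0%VS ->
  exists x a, [/\ x \in X, x != 0 & T x = a *: x].
Proof.
case=> T_sym _; move: H dot T X T_sym; case: hK => V d T X.
- exact: real_eigenvector.
- move=> _; exact: complex_eigenvector.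
Qed.

Lemma orthonormal_cons x s : orthonormal dot (x :: s) =
  [&& dot x x == 1, all (fun y => dot x y == 0) s & orthonormal dot s].
Proof. by rewrite /orthonormal /= andbT -!andbA; congr (_ && _); rewrite andbCA. Qed.

(** Induction on [\dim X]: split off a unit eigenvector [u]; by symmetry of [T] the vectors of [X]
    orthogonal to [u] form a stable subspace. Eigenvalues appear as [b * b] so that a square root
    can be read off. *)
Lemma positive_op_spectral T X : positive_op dot T -> (T @: X <= X)%VS ->
  exists s, [/\ orthonormal dot s, <<s>>%VS = X &
    forall x, x \in s -> exists b, 0 <= b /\ T x = (b * b) *: x].
Proof.
move=> T_pos; have [T_sym T_ge0] := T_pos.
have [n] := ubnP (\dim X); elim: n X => // n IH X; rewrite ltnS => leXn TX.
have [->|X0] := eqVneq X 0%VS; first by exists [::]; rewrite span_nil.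
have [x [a [xX x0 Tx]]] := positive_op_eigenvector T_pos TX X0.
(* [c] is the norm of [x] taken inside [K], so that it can rescale [x]. *)
have [c c0 cc] := nonneg_sqrt hK (dot_ge0 dot x).
have c_neq0 : c != 0 by apply: contraNneq x0 => c0'; rewrite -(dot_eq0 dot) -cc c0' mul0r.
pose u := c^-1 *: x.
have uX : u \in X by rewrite memvZ.
have uu : dot u u = 1.
  rewrite dotZl dotZr (nonneg_conj hK) ?invr_ge0 // -cc.
  by rewrite mulrA mulrACA mulVf // mulr1.
have Tu : T u = a *: u by rewrite linearZ /= Tx !scalerA mulrC.
have a_ge0 : 0 <= a by have := T_ge0 u; rewrite Tu dotZl uu mulr1.
pose Y := (X :&: orthov dot <[u]>)%VS.
have memY y : (y \in Y) = (y \in X) && (dot y u == 0).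
  by rewrite memv_cap mem_orthov1.
have YX : (Y <= X)%VS by exact: capvSl.
have ltYn : (\dim Y < n)%N.
  apply: leq_trans leXn; rewrite (ltn_leqif (dimv_leqif_sup YX)).
  by apply/negP => /subvP /(_ _ uX); rewrite memY uu oner_eq0 andbF.
have TY : (T @: Y <= Y)%VS.
  apply/subvP => _ /memv_imgP[y + ->]; rewrite !memY => /andP[yX /eqP yu].
  by rewrite (subvP TX) ?memv_img // T_sym Tu dotZr yu mulr0 eqxx.
have [s [os sY sT]] := IH _ ltYn TY.
have sub_sY y : y \in s -> y \in Y by rewrite -sY; exact: memv_span.
exists (u :: s); split.
- rewrite orthonormal_cons uu eqxx os andbT; apply/allP => y /sub_sY.
  by rewrite memY => /andP[_ /eqP yu]; rewrite dotC yu rmorph0.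
- apply/eqP; rewrite span_cons sY eqEsubv subv_add YX -memvE uX /=.
  apply/subvP => y yX; rewrite -[y](subrK (dot y u *: u)) addrC.
  apply: memv_add; first by rewrite memvZ ?memv_line.
  rewrite memY rpredB ?memvZ //=.
  by rewrite dotBl dotZl uu mulr1 subrr.
- move=> y; rewrite inE => /predU1P[->|]; last exact: sT.
  by have [b b0 bb] := nonneg_sqrt hK a_ge0; exists b; rewrite bb.
Qed.

Lemma orthonormal_dot s x y : orthonormal dot s -> x \in s -> y \in s ->
  dot x y = (x == y)%:R.
Proof.
elim: s => // z s IH; rewrite orthonormal_cons => /and3P[/eqP zz /allP oz os].
have ozr w : w \in s -> dot w z = 0.
  by move=> /oz /eqP zw; rewrite dotC zw rmorph0.
have zs : z \notin s by apply/negP => /oz; rewrite zz oner_eq0.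
rewrite !inE => /predU1P[->|xs] /predU1P[->|ys].
- by rewrite zz eqxx.
- by have /eqP-> := oz _ ys; rewrite eq_sym (negPf (memPn zs _ ys)).
- by rewrite ozr // (negPf (memPn zs _ xs)).
- exact: IH.
Qed.

Lemma orthonormal_uniq s : orthonormal dot s -> uniq s.
Proof.
elim: s => //= z s IH; rewrite orthonormal_cons => /and3P[/eqP zz /allP oz os].
by rewrite IH // andbT; apply/negP => /oz; rewrite zz oner_eq0.
Qed.

Lemma orthonormal_expansion s x : orthonormal dot s -> x \in <<s>>%VS ->
  x = \sum_(v <- s) dot x v *: v.
Proof.
elim: s x => [x _|z s IH x]; first by rewrite span_nil memv0 big_nil => /eqP.
rewrite orthonormal_cons span_cons => /and3P[/eqP zz /allP oz os].
case/memv_addP=> _ /vlineP[a ->] [w ws ->]; rewrite big_cons.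
have wz : dot w z = 0.
  rewrite (IH w) // dot_suml big_seq big1 // => v /oz /eqP zv.
  by rewrite dotZl [dot v z]dotC zv rmorph0 mulr0.
rewrite dotDl dotZl zz wz addr0 mulr1; congr (_ + _).
rewrite {1}(IH w) //; apply: eq_big_seq => v /oz /eqP zv.
by rewrite dotDl dotZl zv mulr0 add0r.
Qed.

Lemma orthonormal_vectors_free s : orthonormal dot s -> free s.
Proof.
elim: s => [|z s IH]; first by rewrite nil_free.
rewrite orthonormal_cons free_cons => /and3P[/eqP zz /allP oz os].
rewrite IH // andbT; apply/negP => zs.
have := zz; rewrite {2}(orthonormal_expansion os zs) dot_sumr big_seq big1.
  by move/eqP; rewrite eq_sym oner_eq0.
by move=> v /oz /eqP zv; rewrite dotZr zv mulr0.
Qed.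

(** [Q] scales each vector [v] of an orthonormal eigenbasis by the nonnegative root [b v] of its
    eigenvalue. *)
Lemma positive_sqrt_exists T : positive_op dot T ->
  exists Q : 'End(H), positive_op dot Q /\ (Q \o Q)%VF = T.
Proof.
move=> T_pos; have TX : (T @: fullv <= fullv)%VS by exact: subvf.
have [s [os s_span sT]] := positive_op_spectral T_pos TX.
have /choice[b bP] x : exists b, x \in s -> 0 <= b /\ T x = (b * b) *: x.
  by have [/sT[b ?]|] := boolP (x \in s); [exists b | exists 0].
pose q x := \sum_(v <- s) (b v * dot x v) *: v.
have q_lin : linear q.
  move=> a x y; rewrite /q scaler_sumr -big_split; apply: eq_bigr => v _ /=.
  by rewrite dotDl dotZl mulrDr scalerDl scalerA mulrCA.
pose lq := GRing.isLinear.Build K _ _ _ q q_lin.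
pose lq' : {linear H -> H} := HB.pack q lq.
pose Q : 'End(H) := linfun lq'.
have QE x : Q x = q x by rewrite lfunE.
have b_ge0 v : v \in s -> 0 <= b v by case/bP.
exists Q; split; first split => [x y|x].
- rewrite !QE dot_suml dot_sumr; apply: eq_big_seq => v /b_ge0 bv.
  by rewrite dotZl dotZr rmorphM (nonneg_conj hK) // -dotC mulrAC.
- rewrite QE dot_suml big_seq; apply: sumr_ge0 => v /b_ge0 bv.
  by rewrite dotZl [dot v x]dotC -mulrA mulr_ge0 // (mul_conj_ge0 hK).
have Qs v : v \in s -> Q v = b v *: v.
  move=> vs; rewrite QE /q (bigD1_seq v) ?orthonormal_uniq //=.
  rewrite (orthonormal_dot os) // eqxx mulr1 big_seq_cond big1 ?addr0 // => w.
  by case/andP=> ws wv; rewrite (orthonormal_dot os) // eq_sym (negPf wv) mulr0 scale0r.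
apply/(fullv_lfunP _ _ s_span) => v vs.
rewrite comp_lfunE (Qs v vs) linearZ /= Qs // scalerA.
by have [_ ->] := bP v vs.
Qed.

End Spectral.

(** * Orthogonal projections and stability properties of positive operators *)

Section Projection.
Variables (R : realType) (K : numFieldType)
    (conj : {rmorphism K -> K}) (re : K -> R).
Hypothesis (hK : real_or_complex conj re).
Variables (H : vectType K) (dot : {dot H for conj}).
Implicit Types (x y z : H) (X Y : {vspace H}) (T : 'End(H)) (s : seq H).

(* [mem_orthovP] with [dot] itself instead of its underlying Hermitian form, which
   the lemmas on [dot] do not match syntactically. *)
Lemma in_orthovP X x :
  reflect {in X, forall y, dot x y = 0} (x \in orthov dot X).
Proof. exact: mem_orthovP. Qed.

Lemma cap_orthov X : (X :&: orthov dot X)%VS = 0%VS.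
Proof.
apply/eqP; rewrite -subv0; apply/subvP => x; rewrite memv_cap memv0.
by case/andP => xX /in_orthovP/(_ x xX)/eqP; rewrite dot_eq0.
Qed.

Lemma positive_op_id : positive_op dot \1%VF.
Proof. by split=> [x y|x]; rewrite !id_lfunE ?dot_ge0. Qed.

(** The identity is positive and stabilizes every subspace, so the spectral theorem supplies an
    orthonormal basis [s] of [X]; subtracting from [x] its expansion along [s] leaves a vector
    orthogonal to [X]. *)
Lemma add_orthov X : (X + orthov dot X)%VS = fullv.
Proof.
have [|s [os sX _]] := positive_op_spectral (X := X) hK positive_op_id.
  by rewrite lim1g.
apply/eqP; rewrite eqEsubv subvf; apply/subvP => x _.
set p := \sum_(v <- s) dot x v *: v.
have pX : p \in X.
  by rewrite -sX /p big_seq; apply: memv_suml => v vs; rewrite memvZ ?memv_span.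
rewrite -[x](subrK p) addrC; apply: memv_add => //.
apply/in_orthovP => y; rewrite -sX => /(orthonormal_expansion os) ->.
rewrite dot_sumr big_seq big1 // => v vs; rewrite dotZr dotBl /p dot_suml.
rewrite (bigD1_seq v) ?(orthonormal_uniq os) //=.
rewrite dotZl (orthonormal_dot os vs vs) eqxx mulr1 big_seq_cond big1.
  by rewrite addr0 subrr mulr0.
by move=> w /andP[ws /negPf wv]; rewrite dotZl (orthonormal_dot os ws vs) wv mulr0.
Qed.

Lemma oproj_mem X x : oproj dot X x \in X.
Proof. exact: memv_pi. Qed.

Lemma sub_oproj_mem X x : x - oproj dot X x \in orthov dot X.
Proof.
rewrite -{1}[x](daddv_pi_add (cap_orthov X)) ?add_orthov ?memvf //.
by rewrite addrC addKr memv_pi.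
Qed.

Lemma oproj_id X x : x \in X -> oproj dot X x = x.
Proof. exact/daddv_pi_id/cap_orthov. Qed.

Lemma dot_oprojl X x y : y \in X -> dot (oproj dot X x) y = dot x y.
Proof.
move=> yX; apply/esym/eqP; rewrite -subr_eq0 -dotBl.
by have /in_orthovP/(_ y yX)-> := sub_oproj_mem X x.
Qed.

Lemma oproj_sym X x y : dot (oproj dot X x) y = dot x (oproj dot X y).
Proof.
rewrite -[RHS](dot_oprojl _ (oproj_mem _ _)) dotC -(dot_oprojl _ (oproj_mem _ _)).
by rewrite -dotC.
Qed.

Lemma dot_oproj_self X x :
  dot (oproj dot X x) x = dot (oproj dot X x) (oproj dot X x).
Proof. by rewrite [RHS]dot_oprojl ?oproj_mem // oproj_sym. Qed.

Lemma oproj_eq0 X x : x \in orthov dot X -> oproj dot X x = 0.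
Proof.
move=> /in_orthovP xX; apply/eqP; rewrite -(dot_eq0 dot) dot_oprojl ?oproj_mem //.
by rewrite xX ?oproj_mem.
Qed.

(** Pythagoras: the difference of the two sides is the squared norm of [x - oproj dot X x]. *)
Lemma dot_oproj_le X x : dot (oproj dot X x) (oproj dot X x) <= dot x x.
Proof.
have xP : dot x (oproj dot X x) = dot (oproj dot X x) (oproj dot X x).
  by rewrite dot_oprojl ?oproj_mem.
have := dot_ge0 dot (x - oproj dot X x).
by rewrite dotBl !dotBr xP dot_oproj_self subrr subr0 subr_ge0.
Qed.

Lemma positive_op_oproj X : positive_op dot (oproj dot X).
Proof. by split=> [x y|x]; [exact: oproj_sym | rewrite dot_oproj_self dot_ge0]. Qed.

(** Natural coefficients, which [conj] fixes, serve both the fusion frame operator (all equal to 1)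
    and the operator with distinct weights that separates the summands of an orthogonal
    decomposition. *)
Lemma positive_op_sumZ (I : finType) (a : I -> nat) (T : I -> 'End(H)) :
  (forall i, positive_op dot (T i)) -> positive_op dot (\sum_i (a i)%:R *: T i).
Proof.
move=> T_pos; split=> [x y|x]; rewrite !sum_lfunE ?dot_suml ?dot_sumr.
  apply: eq_bigr => i _; rewrite !scale_lfunE dotZl dotZr rmorph_nat.
  by congr (_ * _); exact: (T_pos i).1.
by apply: sumr_ge0 => i _; rewrite scale_lfunE dotZl mulr_ge0 ?ler0n ?(T_pos i).2.
Qed.

Lemma positive_op_inv T : lker T == 0%VS -> positive_op dot T ->
  positive_op dot (T^-1)%VF.
Proof.
move=> T0 [T_sym T_ge0]; split=> [x y|x].
  by rewrite -{2}[x](lker0_lfunVK T0) T_sym (lker0_lfunVK T0).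
by rewrite -{2}[x](lker0_lfunVK T0) -T_sym (lker0_lfunVK T0) -{1}[x](lker0_lfunVK T0).
Qed.

End Projection.

(** * From a Riesz fusion basis to an orthogonal decomposition *)

Section FusionRiesz.
Variables (R : realType) (K : numFieldType)
    (conj : {rmorphism K -> K}) (re : K -> R).
Hypothesis (hK : real_or_complex conj re).
Variables (H : vectType K) (dot : {dot H for conj}).
Variables (m : nat) (W : 'I_m -> {vspace H}).
Local Notation S := (fusion_frame_op dot W).

Lemma fusion_frame_op_positive : positive_op dot S.
Proof.
have -> : S = \sum_i 1%:R *: oproj dot (W i).
  by apply: eq_bigr => i _; rewrite scale1r.
by apply: (positive_op_sumZ (fun=> 1%N)) => i; exact: (positive_op_oproj hK).
Qed.

(** [dot (S x) x] is the sum of the squared norms of the projections of [x]. If it vanishes, [x] is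
    orthogonal to every [W i], hence to itself because the [W i] span. *)
Lemma fusion_frame_op_inj : (\sum_(i < m) W i)%VS = fullv -> lker S == 0%VS.
Proof.
move=> W_span; rewrite -subv0; apply/subvP => x; rewrite memv_ker memv0 => /eqP Sx.
have : dot (S x) x = 0 by rewrite Sx dot0l.
rewrite sum_lfunE dot_suml => /eqP; rewrite psumr_eq0 => [/allP Px|i _]; last first.
  exact: (positive_op_oproj hK dot (W i)).2.
have Px0 i : oproj dot (W i) x = 0.
  apply/eqP; rewrite -(dot_eq0 dot) -(dot_oproj_self hK).
  exact: (Px i (mem_index_enum i)).
have : x \in (\sum_(i < m) W i)%VS by rewrite W_span memvf.
case/memv_sumP=> w wW xE; rewrite -(dot_eq0 dot) {2}xE dot_sumr big1 // => i _.
by rewrite -(dot_oprojl hK dot x (wW i isT)) Px0 dot0l.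
Qed.

(** The lower Riesz bound, taken with [J] the full index set, makes the sum of the squared norms of
    the [f i] nonpositive. *)
Lemma riesz_fusion_basis_direct (f : 'I_m -> H) : riesz_fusion_basis re dot W ->
  (forall i, f i \in W i) -> \sum_i f i = 0 -> forall i, f i = 0.
Proof.
move=> [_ [A [B [A0 _ /(_ [set: 'I_m] f) AB]]]] fW f0 i.
have /andP[+ _] := AB (fun i _ => fW i).
have -> : \sum_(i in [set: 'I_m]) f i = 0.
  by rewrite -[RHS]f0; apply: eq_bigl => j; rewrite inE.
have sumE : \sum_(i in [set: 'I_m]) hnorm re dot (f i) ^+ 2
    = \sum_i hnorm re dot (f i) ^+ 2.
  by apply: eq_bigl => j; rewrite inE.
rewrite sumE (hnorm_sqr hK) dot0l (re0 hK) pmulr_rle0 // => sum_le0.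
have : \sum_i hnorm re dot (f i) ^+ 2 == 0.
  by rewrite eq_le sum_le0 sumr_ge0 // => j _; rewrite sqr_ge0.
rewrite psumr_eq0 => [/allP/(_ i)|j _]; last exact: sqr_ge0.
rewrite mem_index_enum => /(_ isT) /=; rewrite sqrf_eq0 => /eqP.
exact: (hnorm_eq0 hK).
Qed.

Hypothesis riesz : riesz_fusion_basis re dot W.
Local Notation U := (fun i : 'I_m => (inv_sqrt_op dot S @: W i)%VS).

Let S_inj : lker S == 0%VS := fusion_frame_op_inj riesz.1.

(* Both [w] and the projections of [S^-1 w] decompose [w = S (S^-1 w)] along the
   direct sum of the [W i]. *)
Lemma oproj_inv_fusion_frame_op i j w : w \in W j ->
  oproj dot (W i) ((S^-1)%VF w) = if i == j then w else 0.
Proof.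
move=> wW; apply/eqP; rewrite -subr_eq0; apply/eqP; move: i.
apply: riesz_fusion_basis_direct => // [i|].
  by case: eqP => [->|_]; rewrite rpredB ?rpred0 ?oproj_mem.
by rewrite sumrB -sum_lfunE -/S lker0_lfunVK // -big_mkcond big_pred1_eq subrr.
Qed.

(** Since [S^-1] is positive, a square root exists and the choice in [sqrt_op] does not fall back on
    its default value. *)
Lemma inv_sqrt_opP : positive_op dot (inv_sqrt_op dot S) /\
  (inv_sqrt_op dot S \o inv_sqrt_op dot S)%VF = (S^-1)%VF.
Proof.
apply: (xgetPex 0 (P := fun Q : 'End(H) => positive_op dot Q /\ (Q \o Q)%VF = _)).
apply: (positive_sqrt_exists hK); apply: positive_op_inv => //.
exact: fusion_frame_op_positive.
Qed.

(** For [v] in [W i] and [w] in [W j], moving one root across the product turns [dot x y] into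
    [dot v (S^-1 w)], which only sees the projection of [S^-1 w] onto [W i], and that is zero. *)
Lemma inv_sqrt_orthogonal i j x y : i != j -> x \in U i -> y \in U j -> dot x y = 0.
Proof.
move=> /negPf ij /memv_imgP[v vW ->] /memv_imgP[w wW ->].
have [[Q_sym _] QQ] := inv_sqrt_opP.
rewrite Q_sym -[_ (_ w)]comp_lfunE QQ -{1}(oproj_id dot vW) (oproj_sym hK).
by rewrite (oproj_inv_fusion_frame_op i wW) ij dot0r.
Qed.

Lemma inv_sqrt_span : (\sum_(i < m) U i)%VS = fullv.
Proof.
rewrite -limg_sum riesz.1; apply: lker0_limgf.
have [_ QQ] := inv_sqrt_opP; rewrite -subv0; apply/subvP => x.
rewrite memv_ker memv0 => /eqP Qx.
by rewrite -[x](lker0_lfunVK S_inj) -QQ comp_lfunE Qx !linear0.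
Qed.

End FusionRiesz.

(** * Operator norms of rank-one operators *)

Section OperatorNorm.
Variables (R : realType) (K : numFieldType)
    (conj : {rmorphism K -> K}) (re : K -> R).
Hypothesis (hK : real_or_complex conj re).
Variables (H : vectType K) (dot : {dot H for conj}).
Implicit Types (x y f g : H).
Local Notation hnorm := (hnorm re dot).
Local Notation opnorm := (opnorm re dot).

Lemma hnorm_le x y : dot x x <= dot y y -> hnorm x <= hnorm y.
Proof. by move=> xy; apply/ler_wsqrtr/(re_le hK). Qed.

Lemma hnorm0 : hnorm 0 = 0.
Proof. by rewrite /Defs.hnorm dot0l (re0 hK) sqrtr0. Qed.

Lemma hnorm_unit x : dot x x = 1 -> hnorm x = 1.
Proof. by move=> xx; rewrite /Defs.hnorm xx (re1 hK) sqrtr1. Qed.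

Lemma opnorm_le (T : H -> H) (c : R) :
  (forall x, hnorm x <= 1 -> hnorm (T x) <= c) -> opnorm T <= c.
Proof.
move=> Tc; apply: ge_sup; last by move=> _ [x x1 <-]; exact: Tc.
(* Bounding a [sup] from above requires a nonempty set; the zero vector lies in the unit ball. *)
by exists (hnorm (T 0)), 0 => //=; rewrite hnorm0.
Qed.

(** The constant [c] guarantees that the set is bounded, so that its [sup] is an upper bound. *)
Lemma le_opnorm (T : H -> H) (c : R) x :
    (forall x, hnorm x <= 1 -> hnorm (T x) <= c) -> hnorm x <= 1 ->
  hnorm (T x) <= opnorm T.
Proof.
move=> Tc x1; apply: ub_le_sup; last by exists x.
by exists c => _ [y y1 <-]; exact: Tc.
Qed.

(** Expand the squared norm of [x - dot x f *: f], which is nonnegative. *)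
Lemma bessel_unit x f : dot f f = 1 -> dot x f * conj (dot x f) <= dot x x.
Proof.
move=> ff; have := dot_ge0 dot (x - dot x f *: f).
rewrite dotBl !dotBr !dotZl !dotZr ff mulr1 -dotC mulrC subrr subr0.
by rewrite subr_ge0.
Qed.

Lemma hnorm_rank_one_le x f g : dot f f = 1 -> dot g g <= 1 ->
  hnorm (rank_one dot g f x) <= hnorm x.
Proof.
move=> ff gg; apply: hnorm_le; rewrite /rank_one dotZl dotZr mulrA.
apply: le_trans (bessel_unit x ff).
by rewrite -[leRHS]mulr1 ler_wpM2l ?(mul_conj_ge0 hK).
Qed.

Lemma opnorm_rank_one_le1 f g : dot f f = 1 -> dot g g <= 1 ->
  opnorm (rank_one dot g f) <= 1.
Proof.
by move=> ff gg; apply: opnorm_le => x; apply: le_trans; exact: hnorm_rank_one_le.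
Qed.

Lemma opnorm_rank_one0 g : opnorm (rank_one dot g 0) <= 0.
Proof.
by apply: opnorm_le => x _; rewrite /rank_one dot0r scale0r hnorm0.
Qed.

Lemma opnorm_rank_one_unit f : dot f f = 1 -> 1 <= opnorm (rank_one dot f f).
Proof.
(* The norm is attained at [f]: the left side 1 becomes the norm of [rank_one dot f f f], which is
   [f] itself. *)
move=> ff; rewrite -{1}(hnorm_unit ff) -{1}[f]scale1r -{1}ff.
apply: (@le_opnorm (rank_one dot f f) 1); last by rewrite hnorm_unit.
by move=> x; apply: le_trans; apply: hnorm_rank_one_le; rewrite ?ff.
Qed.

End OperatorNorm.

(** * Orthogonal decompositions and bases adapted to them *)

Section OrthogonalDecomposition.
Variables (R : realType) (K : numFieldType)
    (conj : {rmorphism K -> K}) (re : K -> R).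
Hypothesis (hK : real_or_complex conj re).
Variables (H : vectType K) (dot : {dot H for conj}).
Variables (m : nat) (U : 'I_m -> {vspace H}).
Hypothesis U_orth :
  forall i j x y, i != j -> x \in U i -> y \in U j -> dot x y = 0.
Hypothesis U_span : (\sum_(i < m) U i)%VS = fullv.
Local Notation P := (fun i => oproj dot (U i)).

Lemma oproj_orthogonal i j x : i != j -> x \in U j -> P i x = 0.
Proof.
move=> ij xU; apply: (oproj_eq0 hK); apply/in_orthovP => y yU.
by rewrite (U_orth _ xU yU) // eq_sym.
Qed.

Lemma sum_oproj x : \sum_i P i x = x.
Proof.
have : x \in (\sum_(i < m) U i)%VS by rewrite U_span memvf.
case/memv_sumP=> u uU ->; apply: eq_bigr => i _.
rewrite linear_sum (bigD1 i) //= (oproj_id dot (uU i isT)) big1 ?addr0 // => j ji.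
by rewrite (oproj_orthogonal _ (uU j isT)) // eq_sym.
Qed.

(* The eigenvalues of [\sum_i i *: P i] tell the summands [U i] apart, so that each
   of its eigenvectors lies in one of them. *)
Lemma adapted_orthonormal_basis : exists s, [/\ orthonormal dot s, <<s>>%VS = fullv &
  forall x i, x \in s -> P i x = x \/ P i x = 0].
Proof.
pose T := \sum_(i < m) (i : nat)%:R *: P i.
have T_pos : positive_op dot T.
  by apply: (positive_op_sumZ (@nat_of_ord m)) => i; exact: (positive_op_oproj hK).
have [s [os s_span sT]] := positive_op_spectral hK T_pos (subvf _ : (_ <= fullv)%VS).
exists s; split=> // x i xs; have [b [_ Tx]] := sT x xs.
have eigen (k : 'I_m) : (k%:R - b * b) *: P k x = 0.
  have PTx : (b * b) *: P k x = P k (T x) by rewrite Tx linearZ.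
  rewrite scalerBl PTx sum_lfunE linear_sum (bigD1 k) //= big1.
    by rewrite addr0 scale_lfunE linearZ /= (oproj_id dot (oproj_mem dot (U k) x)) subrr.
  move=> j jk; rewrite scale_lfunE linearZ /=.
  by rewrite (oproj_orthogonal _ (oproj_mem _ _ _)) ?scaler0 // eq_sym.
have [Pix|Pix] := eqVneq (P i x) 0; [by right | left].
(* A nonzero [P i x] forces the eigenvalue [b * b] to be [i]; any other nonzero [P j x] would force
   it to be [j] as well. *)
rewrite -[RHS]sum_oproj (bigD1 i) //= big1 ?addr0 // => j ji.
have /eqP := eigen i; rewrite scaler_eq0 (negPf Pix) orbF subr_eq0 => /eqP ib.
have /eqP := eigen j; rewrite scaler_eq0 -ib subr_eq0 eqr_nat => /orP[|/eqP//].
by move=> /eqP/val_inj ji'; rewrite ji' eqxx in ji.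
Qed.

(** * The projected basis: Parseval property, duals and optimality *)

Section Frame.
Variables (n : nat) (e : n.-tuple H).
Hypothesis e_basis : orthonormal_basis dot e.
Hypothesis e_adapted : forall j i,
  P i (tnth e j) = tnth e j \/ P i (tnth e j) = 0.
Local Notation F := (proj_family dot e U).

Lemma basis_expansion x : x = \sum_j dot x (tnth e j) *: tnth e j.
Proof.
rewrite -(big_tuple _ _ e xpredT (fun v => dot x v *: v)).
apply: (orthonormal_expansion e_basis.1).
by rewrite (span_basis e_basis.2) memvf.
Qed.

Lemma basis_parseval x :
  \sum_j dot x (tnth e j) * conj (dot x (tnth e j)) = dot x x.
Proof.
rewrite [in X in _ = _ _ X](basis_expansion x) dot_sumr.
by apply: eq_bigr => j _; rewrite dotZr mulrC.
Qed.

Lemma dot_basis j k : dot (tnth e j) (tnth e k) = (j == k)%:R.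
Proof.
rewrite (orthonormal_dot e_basis.1) ?mem_tnth // inj_eq //.
exact/tuple_uniqP/(orthonormal_uniq e_basis.1).
Qed.

(** By symmetry of [P i], Parseval for [e] at [P i f] sums the terms of index [i] to
    [dot (P i f) f]; summing over [i] gives [dot f f]. *)
Lemma proj_family_parseval : parseval_frame re dot F.
Proof.
split=> [|f].
  apply/eqP; rewrite eqEsubv subvf; apply/subvP => x _.
  rewrite (basis_expansion x); apply: memv_suml => j _; rewrite memvZ //.
  rewrite -[tnth e j]sum_oproj; apply: memv_suml => i _.
  by apply/memv_span/codomP; exists (j, i).
under eq_bigr do rewrite (modulus_sqr hK).
rewrite -(re_sum hK) (hnorm_sqr hK); congr re.
rewrite -(pair_bigA _ (fun j i => dot f (F (j, i)) * conj (dot f (F (j, i))))) /=.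
rewrite exchange_big /= -[in X in _ = _ X _](sum_oproj f) dot_suml.
apply: eq_bigr => i _; rewrite (dot_oproj_self hK) -basis_parseval.
by apply: eq_bigr => j _; rewrite /proj_family /= (oproj_sym hK).
Qed.

(** For fixed [i] the sum over [j] is the projection onto [V i] of [P i f], which is [P i f] because
    [U i] lies in [V i]. *)
Lemma proj_family_dual (V : 'I_m -> {vspace H}) : (forall i, (U i <= V i)%VS) ->
  dual_frame dot F (proj_family dot e V).
Proof.
move=> UV f.
rewrite -(pair_bigA _ (fun j i => dot f (F (j, i)) *: proj_family dot e V (j, i))) /=.
rewrite exchange_big /= -[RHS]sum_oproj; apply: eq_bigr => i _.
rewrite -[RHS](oproj_id dot (subvP (UV i) _ (oproj_mem dot (U i) f))).
rewrite [in RHS](basis_expansion (P i f)) linear_sum; apply: eq_bigr => j _.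
by rewrite linearZ /= /proj_family /= (oproj_sym hK).
Qed.

(** In the reconstruction of [tnth e k.1] from [Y], every term but that of [k] vanishes: entries
    with the same [j] lie in another, orthogonal [U i'], and entries with another [j'] are 0 or a
    different basis vector. *)
Lemma dual_frame_adapted (Y : 'I_n * 'I_m -> H) k : dual_frame dot F Y ->
  F k = tnth e k.1 -> Y k = tnth e k.1.
Proof.
case: k => j i dualY /= Fk; rewrite -[RHS]dualY (bigD1 (j, i)) //= Fk dot_basis.
rewrite eqxx scale1r big1 ?addr0 // => -[j' i'] /= neq.
have [jj'|jj'] := eqVneq j j'.
  have ii' : i != i' by apply: contraNneq neq => ->; rewrite jj'.
  rewrite -Fk -jj' (U_orth ii') ?scale0r //; exact: oproj_mem.
by have [E|E] := e_adapted j' i'; rewrite /proj_family /= E;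
  rewrite ?dot0r ?dot_basis ?(negPf jj') scale0r.
Qed.

(** The maximum is bounded term by term. The value 1 is compared with [d1 F Y] only at an index
    where [F k] is a basis vector, so an empty basis raises no exception. *)
Lemma proj_family_optimal (V : 'I_m -> {vspace H}) : (forall i, (U i <= V i)%VS) ->
  one_loss_optimal_dual re dot F (proj_family dot e V).
Proof.
move=> UV; split=> [|Y dualY]; first exact: proj_family_dual.
apply: bigmax_le => [|k _]; first exact: bigmax_ge_id.
have e1 : dot (tnth e k.1) (tnth e k.1) = 1 by rewrite dot_basis eqxx.
have [Fk|Fk] := e_adapted k.1 k.2; rewrite -/(F k) in Fk; last first.
  by rewrite Fk; apply: le_trans (opnorm_rank_one0 hK _ _) (bigmax_ge_id _ _ _ _).
apply: (@le_trans _ _ 1).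
  rewrite Fk; apply: opnorm_rank_one_le1 => //; rewrite -e1; exact: (dot_oproj_le hK).
apply: le_trans (le_bigmax _ _ k).
by rewrite (dual_frame_adapted dualY Fk) Fk opnorm_rank_one_unit.
Qed.

End Frame.
End OrthogonalDecomposition.

Theorem theorem4p5 (R : realType) (K : numFieldType)
    (conj : {rmorphism K -> K}) (re : K -> R) (hK : real_or_complex conj re)
    (H : vectType K) (dot : {dot H for conj}) (n : nat) (hn : \dim {:H} = n)
    (m : nat) (W : 'I_m -> {vspace H})
    (hW : riesz_fusion_basis re dot W) (hW' : nontrivial_family W) :
  let U := fun i : 'I_m => (inv_sqrt_op dot (fusion_frame_op dot W) @: W i)%VS in
  exists e : n.-tuple H,
    [/\ orthonormal_basis dot e,
        parseval_frame re dot (proj_family dot e U) &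
        forall V : 'I_m -> {vspace H}, (forall i, (U i <= V i)%VS) ->
          one_loss_optimal_dual re dot (proj_family dot e U)
            (proj_family dot e V)].
Proof.
move=> U.
have U_orth := inv_sqrt_orthogonal hK hW; rewrite -/U in U_orth.
have U_span : (\sum_(i < m) U i)%VS = fullv := inv_sqrt_span hK hW.
have [s [os s_span s_adapted]] := adapted_orthonormal_basis hK U_orth U_span.
have s_free := orthonormal_vectors_free os.
(* [free s] is by definition the equality of [\dim <<s>>] and [size s]. *)
have s_size : size s == n by rewrite -hn -s_span eq_sym -/(free s).
pose e := Tuple s_size.
have e_basis : orthonormal_basis dot e.
  by split=> //; apply/andP; split; first exact/eqP.
have e_adapted j i : oproj dot (U i) (tnth e j) = tnth e j \/
    oproj dot (U i) (tnth e j) = 0 by apply: s_adapted; exact: mem_tnth.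
exists e; split=> // [|V UV].
- exact: (proj_family_parseval hK U_orth U_span e_basis).
- exact: (proj_family_optimal hK U_orth U_span e_basis e_adapted UV).
Qed.
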